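(* Let $I\subset\mathbb{R}$ be an open interval and let $a,b\in I$ with $a<b$. Let $f:I\to\mathbb{R}$ be a twice differentiable mapping such that $f''$ is integrable on $[a,b]$, and let $0\le\lambda\le 1$. Then $$(\lambda-1)f\left(\frac{a+b}{2}\right)-\lambda\frac{f(a)+f(b)}{2}+\frac{1}{b-a}\int_a^b f(x)\,dx=(b-a)^2\int_0^1 k(t)f''(ta+(1-t)b)\,dt,$$ where $$k(t)=\begin{cases}\frac12 t(t-\lambda), & 0\le t\le\frac12,\\ \frac12(1-t)(1-\lambda-t), & \frac12\le t\le 1.\end{cases}$$
   Context: The two formulas defining $k$ agree at $t=\frac12$, so $k$ is well defined on $[0,1]$. *)

(* Defs.v *)
From HB Require Import structures.
From mathcomp Require Import all_boot all_order all_algebra.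
From mathcomp Require Import all_classical all_reals all_analysis.
From mathcomp Require Import lra.
Set Implicit Arguments.
Unset Strict Implicit.
Unset Printing Implicit Defensive.
Import Order.TTheory GRing.Theory Num.Theory.
Import numFieldNormedType.Exports.
Local Open Scope classical_set_scope.
Local Open Scope ring_scope.

(* Only the values on [0, 1] are meaningful. *)
Definition kernel_k (R : realType) (lambda t : R) : R :=
  if t <= 1 / 2 then 1 / 2 * t * (t - lambda)
  else 1 / 2 * (1 - t) * (1 - lambda - t).

(* The two formulas agree at t = 1/2. *)
Lemma kernel_k_right (R : realType) (lambda t : R) : 1 / 2 <= t ->
  kernel_k lambda t = 1 / 2 * (1 - t) * (1 - lambda - t).
Proof.
rewrite /kernel_k; case: ifP => // t_le t_ge.
have -> : t = 1 / 2 by lra.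
by lra.
Qed.

(* Main.v *)
Require Import Defs.
From HB Require Import structures.
From mathcomp Require Import all_boot all_order all_algebra.
From mathcomp Require Import all_classical all_reals all_analysis.
From mathcomp Require Import measurable_realfun ring lra.
Set Implicit Arguments.
Unset Strict Implicit.
Unset Printing Implicit Defensive.
Import Order.TTheory GRing.Theory Num.Theory.
Import numFieldNormedType.Exports.
Local Open Scope classical_set_scope.
Local Open Scope ring_scope.

(** Integrate by parts twice on each half of [a, b]. With L = b - a, the
    substitution x = t a + (1 - t) b turns k(t) into q(min(x - a, b - x)), where
    q(y) = 1/2 (y / L) (y / L - lambda): it is q(x - a) on the left half and
    q(b - x) on the right half. As q'' is the constant L^-2, each half
    contributes L^-2 times the integral of f, plus boundary terms. The terms in
    f' cancel at the midpoint, because both halves carry the weight q(L / 2)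
    there, and vanish at a and b, because q(0) = 0. The terms in f are those of
    the statement.

    The second derivative is only assumed to exist everywhere and to be Lebesgue
    integrable; it need not be continuous, so integration by parts cannot rest
    on the fundamental theorem of calculus for continuous integrands. The
    theorem needed is [Rintegral_derive1]: an everywhere differentiable function
    with integrable derivative is the integral of that derivative. Applied to
    u f' - u' f it gives [Rintegral_Green].

    The proof of [Rintegral_derive1] follows Vitali and Caratheodory. A
    nonnegative integrable u is dominated, up to epsilon in total mass, by a
    measure W that near each point x grows at a rate strictly larger than u(x)
    ([open_majorant_measure]; W has the density which is a sum of multiples of
    indicators of open sets). If F' <= u then W(]a, x]) - F(x) increases across
    every point, hence on the whole interval ([locally_nondecreasing_le]), so
    that F(b) - F(a) <= W([a, b]) ([derive1_ge0_le_integral]). The sign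
    condition on u is removed by truncating F' from below and dominated
    convergence ([derive1_le_integral]); applying the inequality to F and to - F
    gives the equality.

    The substitution is also carried out for a merely integrable function, from
    the scaling of Lebesgue measure under affine maps ([Rintegral_affine]). *)

(** * A measure majorant of a nonnegative integrable function *)

(** Cut the range of u into slices [n d, (n + 1) d[ and enclose the part E_n of
    D lying over the n-th slice in an open set U_n that exceeds it by very
    little. The measure W with density sum_n (n + 1) d 1_(U_n) costs
    little more than u, and since U_n is open the lower bound (n + 1) d > u(x)
    holds on a whole neighbourhood of each x in E_n. This is the lower
    semicontinuous majorant of Vitali and Caratheodory, in terms of measures. *)
Lemma open_majorant_measure (R : realType) (D : set R) (u : R -> R) (e : R) :
    measurable D -> (@lebesgue_measure R D < +oo)%E ->
    measurable_fun D u -> (forall x, D x -> 0 <= u x) -> 0 < e ->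
  exists W : {measure set (measurableTypeR R) -> \bar R},
    (W D <= \int[@lebesgue_measure R]_(x in D) (u x)%:E + e%:E)%E /\
    forall x, D x -> exists2 U, open_nbhs x U & exists2 c, u x < c &
      forall A, measurable A -> A `<=` U ->
        (c%:E * @lebesgue_measure R A <= W A)%E.
Proof.
move=> mD Dfin mu u0 e0.
set L := @lebesgue_measure R.
(* Slicing costs d * |D| and enclosing the slices costs d: e in total. *)
pose d : R := e / (fine (L D) + 1).
have LD0 : 0 <= fine (L D) by exact: fine_ge0.
have d0 : 0 < d by rewrite divr_gt0// ltr_wpDl.
pose E n := D `&` u @^-1` `[n%:R * d, n.+1%:R * d[.
have mE n : measurable (E n) by exact: mu.
have EfinD n : (L (E n) < +oo)%E.
  apply: le_lt_trans Dfin; apply: le_measure; rewrite ?inE.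
  - exact: mE.
  - exact: mD.
  - exact: subIsetl.
(* The n-th slice has weight (n + 1) d; its excess costs d / 2 ^ (n + 1). *)
pose r n : R := (2 ^ n.+1)%:R^-1 / n.+1%:R.
have r0 n : 0 < r n by rewrite divr_gt0// invr_gt0 ltr0n expn_gt0.
have /choice[U UE] : forall n, exists U : set R,
    [/\ open U, E n `<=` U & (L (U `\` E n) < (r n)%:E)%E].
  by move=> n; exact: lebesgue_regularity_outer.
have mU n : measurable (U n) by apply: open_measurable; case: (UE n).
have c0 n : 0 <= n.+1%:R * d by rewrite mulr_ge0// ltW.
pose W := mseries (fun n => mscale (NngNum (c0 n)) (mrestr L (mU n))) 0.
have bigE : \bigcup_n E n = D.
  apply/seteqP; split=> [x [n _ []//]|x Dx].
  exists (Num.truncn (u x / d)) => //; split => //=.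
  have ud0 : 0 <= u x / d by rewrite divr_ge0 ?u0// ltW.
  have /andP[ud1 ud2] := truncn_itv ud0.
  by rewrite in_itv/= -ler_pdivlMr// ud1 -ltr_pdivrMr.
exists W; split.
  have WE : (W D <= \sum_(n <oo) ((n.+1%:R * d)%:E * L (E n) +
                       (d / (2 ^ n.+1)%:R)%:E))%E.
    apply: lee_nneseries => [n _ _|n _]; first exact: mule_ge0.
    rewrite /= /mscale/= /mrestr.
    have -> : (d / (2 ^ n.+1)%:R)%:E = ((n.+1%:R * d)%:E * (r n)%:E)%E.
      rewrite -EFinM /r; congr (_%:E).
      by field; rewrite nat1r !pnatr_eq0 expn_eq0.
    rewrite -ge0_muleDr//; last by rewrite lee_fin ltW.
    apply: lee_pmul => //; first by rewrite lee_fin.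
    have [_ EU UEr] := UE n.
    apply: (@le_trans _ _ (L (U n))).
      by apply: le_measure; rewrite ?inE;
        [exact: (measurableI _ _ mD (mU n))|exact: mU|exact: subIsetr].
    have -> : L (U n) = (L (E n) + L (U n `\` E n))%E.
      rewrite -measureU; [by rewrite setDUK|exact: mE| |by rewrite setDIK].
      by apply: measurableD; [exact: mU|exact: mE].
    by rewrite leeD2l// ltW.
  apply: (le_trans WE).
  rewrite nneseriesD; last 2 first.
    by move=> n _ _; rewrite mule_ge0// lee_fin.
    by move=> n _ _; rewrite lee_fin divr_ge0// ltW.
  have H1 : (\sum_(n <oo) ((n.+1%:R * d)%:E * L (E n)) <=
      \int[L]_(x in D) (u x)%:E + d%:E * L D)%E.
    apply: (@le_trans _ _ (\int[L]_(x in D) (u x + d)%:E)%E).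
      rewrite -bigE ge0_integral_bigcup//.
      - apply: lee_nneseries => [n _ _|n _].
          by rewrite mule_ge0// lee_fin.
        rewrite -(integral_cst L (mE n)); apply: ge0_le_integral.
        + exact: mE.
        + by move=> x _; rewrite lee_fin.
        + exact: measurable_cst.
        + apply/measurable_EFinP; apply: measurable_funD; last first.
            exact: measurable_cst.
          by apply: measurable_funS mu; [exact: mD|exact: subIsetl].
        + move=> x [Dx /=]; rewrite in_itv/= => /andP[+ _].
          by rewrite lee_fin -natr1 mulrDl mul1r lerD2r.
      - rewrite bigE; apply/measurable_EFinP; exact: measurable_funD.
      - by rewrite bigE => x Dx; rewrite lee_fin addr_ge0 ?u0// ltW.
      - apply/trivIsetP => i j _ _; wlog ij : i j / (i < j)%N.
          move=> W0; rewrite neq_ltn => /orP[ij|ij].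
            by apply: W0 => //; rewrite neq_ltn ij.
          by rewrite setIC; apply: W0 => //; rewrite neq_ltn ij.
        move=> _; rewrite -subset0 => x [[_ /=]].
        rewrite in_itv/= => /andP[_ xi] [_ /=]; rewrite in_itv/= => /andP[xj _].
        have := le_lt_trans xj xi; rewrite ltr_pM2r// ltr_nat ltnS.
        by rewrite leqNgt ij.
    under eq_integral do rewrite EFinD.
    rewrite ge0_integralD//; [by rewrite (integral_cst L mD)| | ].
    - exact/measurable_EFinP.
    - by move=> x _; rewrite lee_fin ltW.
  have H2 := @epsilon_trick0 R d xpredT (ltW d0).
  apply: (le_trans (leeD H1 H2)).
  rewrite -addeA leeD2l//.
  have -> : L D = (fine (L D))%:E by rewrite fineK// ge0_fin_numE.
  rewrite -EFinM -EFinD lee_fin -{2}(mulr1 d) -mulrDr mulfVK//.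
  by rewrite gt_eqF// ltr_wpDl.
move=> x Dx.
have [n _ Enx] : (\bigcup_n E n) x by rewrite bigE.
have [oU EU _] := UE n.
exists (U n); first by split => //; exact: EU.
exists (n.+1%:R * d).
  by case: Enx => _ /=; rewrite in_itv/= => /andP[].
move=> A mA AU.
have := @nneseries_lim_ge R
  (fun n => mscale (NngNum (c0 n)) (mrestr L (mU n)) A) xpredT 0 n.+1.
move=> /(_ (fun k _ _ => measure_ge0 _ _)); apply: le_trans.
have WnA : mscale (NngNum (c0 n)) (mrestr L (mU n)) A =
    ((n.+1%:R * d)%:E * L A)%E.
  by rewrite /mscale/= /mrestr setIidl.
by rewrite big_nat_recr// WnA leeDr// sume_ge0.
Qed.

(** * Functions increasing across every point *)

(** Let S be the set of x in [a, b] with G a <= G x. Some s in S lies just below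
    sup S, or equals it, and comparing s with a point t just above sup S, capped
    at b, shows that t is in S too. Hence t = b. The hypothesis compares points
    on both sides of x, so that s and t are compared directly, without passing
    to a limit at sup S; this matters because the function it is applied to
    below contains the distribution function of a measure. *)
Lemma locally_nondecreasing_le (R : realType) (G : R -> R) (a b : R) :
    a <= b ->
    (forall x, a <= x <= b -> \forall d \near 0^'+, forall s t,
      a <= s -> t <= b -> x - d <= s <= x -> x <= t <= x + d -> G s <= G t) ->
  G a <= G b.
Proof.
move=> ab locG; pose S := [set x | a <= x <= b /\ G a <= G x].
have Sa : S a by split; rewrite ?lexx.
have ubS : ubound S b by move=> x [/andP[]].
have supS : has_sup S by split; [exists a|exists b].
have aS : a <= sup S by apply: ub_le_sup => //; exists b.
have Sb : sup S <= b by apply: ge_sup => //; exists a.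
have aSb : a <= sup S <= b by rewrite aS.
have [d [Gd /= d0]] := filter_ex (filterI (locG _ aSb) (nbhs_right_gt 0)).
have [s [/andP[sa sb] Gas] sS] := sup_adherent d0 supS.
pose t := Num.min b (sup S + d).
have Gat : G a <= G t.
  apply: (le_trans Gas); apply: Gd => //; first by rewrite ge_min lexx.
    by rewrite (ltW sS) ub_le_sup//; [exists b|split; rewrite ?sa].
  by rewrite le_min Sb lerDl (ltW d0)/= ge_min lexx orbT.
have St : S t.
  split => //; rewrite ge_min lexx andbT le_min ab/=.
  by rewrite (le_trans aS)// lerDl ltW.
suff tb : t = b by rewrite -tb.
have : t <= sup S by apply: ub_le_sup => //; exists b.
rewrite /t; have [//|_] := leP b (sup S + d).
by rewrite gerDl => /(lt_le_trans d0); rewrite ltxx.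
Qed.

(** The two points s and t may straddle x; both difference quotients from x are
    less than c, and the increments add up. *)
Lemma derive1_lt_near (R : realType) (F : R -> R) (x c : R) :
    derivable F x 1 -> derive1 F x < c ->
  \forall d \near 0^'+, forall s t, x - d <= s <= x -> x <= t <= x + d ->
    F t - F s <= c * (t - s).
Proof.
move=> dF Fxc.
have cF : h^-1 *: (F (h + x) - F x) @[h --> 0^'] --> derive1 F x.
  rewrite derive1E.
  suff -> : (fun h => h^-1 *: (F (h + x) - F x)) =
      (fun h => h^-1 *: ((F \o shift x) (h *: 1) - F x)) by exact: dF.
  by apply/funext => h /=; rewrite [h%:A]mulr1.
have [e /= e0 Fe] := cvgr_lt _ cF _ Fxc.
near=> d => s t /andP[ds sx] /andP[xt td].
have de : d < e by near: d; exact: nbhs_right_lt.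
rewrite -(subrKA (F x)) -(subrKA x t) mulrDr lerD//.
- have [->|tx] := eqVneq t x; first by rewrite !subrr mulr0.
  have tx0 : 0 < t - x by rewrite subr_gt0 lt_neqAle eq_sym tx.
  have := Fe (t - x); rewrite /= sub0r normrN subrK => /(_ _ _)/ltW.
  rewrite ler_pdivrMl// mulrC; apply; last by rewrite gt_eqF.
  by rewrite gtr0_norm// (le_lt_trans _ de)// lerBlDl.
- have [->|nsx] := eqVneq s x; first by rewrite !subrr mulr0.
  have sx0 : s - x < 0 by rewrite subr_lt0 lt_neqAle nsx.
  have := Fe (s - x); rewrite /= sub0r normrN subrK => /(_ _ _)/ltW.
  rewrite ler_ndivrMl// mulrC -(opprB s) mulrN lerNr opprB.
  apply; last by rewrite lt_eqF.
  by rewrite ltr0_norm// opprB (le_lt_trans _ de)// lerBlDl -lerBlDr.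
Unshelve. all: by end_near. Qed.

(** * The fundamental theorem of calculus for integrable derivatives *)

(** The function W(]a, x]) - F(x) is increasing across every x: on a small
    interval around x, the measure W has density at least some c > u(x) while
    the increments of F have slope at most c. *)
Lemma derive1_ge0_le_integral (R : realType) (F u : R -> R) (a b : R) :
    a <= b -> (forall x, a <= x <= b -> derivable F x 1) ->
    (forall x, a <= x <= b -> derive1 F x <= u x) ->
    (forall x, a <= x <= b -> 0 <= u x) ->
    (@lebesgue_measure R).-integrable `[a, b] (EFin \o u) ->
  ((F b - F a)%:E <= \int[@lebesgue_measure R]_(x in `[a, b]) (u x)%:E)%E.
Proof.
move=> ab dF Fu u0 iu; set L := @lebesgue_measure R.
have mD : measurable `[a, b]%classic by exact: measurable_itv.
have Dfin : (L `[a, b]%classic < +oo)%E.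
  by rewrite /L lebesgue_measure_itv; case: ifP => // _; rewrite ltry.
have mu : measurable_fun `[a, b] u.
  by apply/measurable_EFinP; exact: measurable_int iu.
apply/lee_addgt0Pr => e e0.
have [|W [WD Wloc]] := open_majorant_measure mD Dfin mu _ e0.
  by move=> x; rewrite /= in_itv/=; exact: u0.
have Wfin s t : a <= s -> t <= b -> W `]s, t]%classic \is a fin_num.
  move=> as_ tb; rewrite ge0_fin_numE//.
  apply: (@le_lt_trans _ _ (W `[a, b]%classic)).
    apply: le_measure; rewrite ?inE; try exact: measurable_itv.
    by apply: subset_itv; rewrite bnd_simp.
  apply: (le_lt_trans WD); rewrite -ge0_fin_numE//; last first.
    apply: adde_ge0; last by rewrite lee_fin ltW.
    by apply: integral_ge0 => x; rewrite /= in_itv/= lee_fin; exact: u0.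
  by rewrite fin_numD/= andbT; exact: integrable_fin_num.
apply: le_trans WD.
apply: (@le_trans _ _ (W `]a, b]%classic)); last first.
  apply: le_measure; rewrite ?inE; try exact: measurable_itv.
  exact: subset_itv_oc_cc.
pose G x := fine (W `]a, x]%classic) - F x.
suff : G a <= G b.
  rewrite /G set_itvoc0 measure0 sub0r lerNl opprB lerBlDr -lerBlDl => FW.
  by rewrite -(@fineK _ (W _)) ?Wfin// lee_fin.
apply: locally_nondecreasing_le => // x xab.
have [|U [oU Ux] [c uc WU]] := Wloc x; first by rewrite /= in_itv.
have Fc := derive1_lt_near (dF _ xab) (le_lt_trans (Fu _ xab) uc).
have [e1 /= e10 xU] := oU _ Ux.
near=> d => s t as_ tb /andP[ds sx] /andP[xt td].
have st : s <= t by exact: le_trans xt.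
have Fst : F t - F s <= c * (t - s).
  by apply: (near Fc d) => //; rewrite ?ds ?xt.
have Wat : W `]a, t]%classic = (W `]a, s]%classic + W `]s, t]%classic)%E.
  rewrite -measureU; [|exact: measurable_itv|exact: measurable_itv|].
    by rewrite -itv_bndbnd_setU// bnd_simp.
  rewrite -subset0 => y [/=]; rewrite !in_itv/= => /andP[_ ys] /andP[/lt_geF].
  by rewrite ys.
have sb : s <= b by exact: le_trans tb.
rewrite /G Wat fineD ?Wfin// -addrA lerD2l lerBrDr addrC (le_trans Fst)//.
rewrite -lee_fin fineK ?Wfin//.
have -> : (c * (t - s))%:E = (c%:E * L `]s, t]%classic)%E.
  rewrite /L lebesgue_measure_itv/= lte_fin; move: st.
  rewrite le_eqVlt => /predU1P[->|->]; last by rewrite EFinM EFinB.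
  by rewrite ltxx subrr mulr0 mule0.
apply: WU; first exact: measurable_itv.
move=> y /=; rewrite in_itv/= => /andP[sy yt]; apply: xU => /=.
have de : d < e1 by near: d; exact: nbhs_right_lt.
by rewrite ltr_norml; apply/andP; split; lra.
Unshelve. all: by end_near. Qed.

(** The derivative h is truncated to hN n = max(h, - n). Adding n x to F shifts
    the derivative by n, and h + n <= hN n + n with hN n + n >= 0, so that the
    preceding lemma applies; the contribution n (b - a) then cancels on both
    sides. Finally hN n converges to h and is dominated by |h|. *)
Lemma derive1_le_integral (R : realType) (F : R -> R) (a b : R) :
    a <= b -> (forall x, a <= x <= b -> derivable F x 1) ->
    (@lebesgue_measure R).-integrable `[a, b] (EFin \o derive1 F) ->
  ((F b - F a)%:E <=
    \int[@lebesgue_measure R]_(x in `[a, b]) (derive1 F x)%:E)%E.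
Proof.
move=> ab dF ih; set h := derive1 F; set L := @lebesgue_measure R.
have mD : measurable `[a, b]%classic by exact: measurable_itv.
have Dab : L `[a, b]%classic = (b - a)%:E.
  rewrite /L lebesgue_measure_itv/= lte_fin EFinB; move: ab.
  by rewrite le_eqVlt => /predU1P[->|->//]; rewrite ltxx subee.
have mh : measurable_fun `[a, b] h.
  by apply/measurable_EFinP; exact: measurable_int ih.
pose hN (n : nat) x := Num.max (h x) (- n%:R).
have mhN n : measurable_fun `[a, b] (hN n).
  by apply: measurable_maxr => //; exact: measurable_cst.
have hNh n x : `|hN n x| <= `|h x|.
  rewrite /hN; have [hx|//] := leP (h x) (- n%:R).
  have n0 : 0 <= n%:R :> R by [].
  by rewrite normrN ger0_norm// ler0_norm; lra.
have ihN n : L.-integrable `[a, b] (EFin \o hN n).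
  apply: (le_integrable _ _ _ ih) => //.
    by apply/measurable_EFinP; exact: mhN.
  by move=> x _ /=; rewrite lee_fin.
have FhN n : ((F b - F a)%:E <= \int[L]_(x in `[a, b]) (hN n x)%:E)%E.
  pose G x := F x + n%:R * x.
  have dG x : a <= x <= b -> is_derive x (1 : R) G (h x + n%:R).
    move=> /dF dFx; have dFx' := DeriveDef dFx (esym (derive1E F x)).
    rewrite -[X in _ + X]mulr1; exact: is_deriveD.
  have iN : L.-integrable `[a, b] (EFin \o cst n%:R).
    apply: continuous_compact_integrable; first exact: segment_compact.
    by apply: continuous_subspaceT => x; exact: cvg_cst.
  have iG : L.-integrable `[a, b] (EFin \o (fun x => hN n x + n%:R)).
    rewrite (_ : _ \o _ = (EFin \o hN n) \+ (EFin \o cst n%:R))//.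
    exact: integrableD.
  have := @derive1_ge0_le_integral R G (fun x => hN n x + n%:R) a b ab.
  rewrite integralD_EFin// integral_cst//.
  have -> : (n%:R%:E * L `[a, b]%classic)%E = (n%:R * (b - a))%:E.
    by rewrite Dab.
  rewrite -leeBlDr// -EFinB.
  have -> : G b - G a - n%:R * (b - a) = F b - F a by rewrite /G; ring.
  apply => // x xab; have dGx := dG x xab.
  - exact: ex_derive.
  - by rewrite derive1E derive_val lerD2r /hN le_max lexx.
  - by rewrite -lerBlDr sub0r /hN le_max lexx orbT.
have [| | | | |_ _] := @dominated_convergence _ _ R L _ mD
    (fun n => EFin \o hN n) (EFin \o h) (EFin \o (fun x => `|h x|)).
- by move=> n; apply/measurable_EFinP; exact: mhN.
- by apply/measurable_EFinP; exact: mh.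
- apply: aeW => x _; apply: cvg_near_cst; near=> n => /=; congr EFin.
  apply/max_idPl; rewrite lerNl.
  by near: n; exact: nbhs_infty_ger.
- exact: integrable_norm.
- by apply: aeW => x n _ /=; rewrite lee_fin.
by apply: cvge_ge; near=> n; exact: FhN.
Unshelve. all: by end_near. Qed.

(** The inequality for - F is the reverse of the one for F. *)
Theorem Rintegral_derive1 (R : realType) (F : R -> R) (a b : R) :
    a <= b -> (forall x, a <= x <= b -> derivable F x 1) ->
    (@lebesgue_measure R).-integrable `[a, b] (EFin \o derive1 F) ->
  (\int[@lebesgue_measure R]_(x in `[a, b]) derive1 F x)%R = F b - F a.
Proof.
move=> ab dF iF; set L := @lebesgue_measure R.
have dNF x : x \in `[a, b]%classic -> derive1 (- F) x = - derive1 F x.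
  by rewrite inE/= in_itv/= => /dF dFx; rewrite !derive1E deriveN.
have finF : (\int[L]_(x in `[a, b]) (derive1 F x)%:E)%E \is a fin_num.
  exact: integrable_fin_num.
have FL := derive1_le_integral ab dF iF.
have NFL : ((- F b + F a)%:E <=
    \int[L]_(x in `[a, b]) (- derive1 F x)%:E)%E.
  have := @derive1_le_integral R (- F) a b ab.
  rewrite (_ : (- F) b - (- F) a = - F b + F a); last by rewrite !fctE opprK.
  have -> : (\int[L]_(x in `[a, b]) (derive1 (- F) x)%:E =
             \int[L]_(x in `[a, b]) (- derive1 F x)%:E)%E.
    by apply: eq_integral => x xab; rewrite dNF.
  apply => [x /dF dFx|]; first exact: derivableN.
  apply: (@eq_integrable _ _ _ L _ _ (-%E \o (EFin \o derive1 F))) => //.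
    by move=> x xab /=; rewrite dNF.
  exact: integrableN.
apply/eqP; rewrite eq_le -!lee_fin fineK// FL andbT.
move: NFL; under [X in (_ <= X)%E -> _]eq_integral do rewrite EFinN.
rewrite integralN/=; last exact: integrable_add_def.
by rewrite leeNr -EFinN opprD opprK.
Qed.

(** * Affine change of variables *)

Lemma measurable_affine (R : realType) (c d : R) :
  measurable_fun setT
    (fun x : measurableTypeR R => (c * x + d : measurableTypeR R)).
Proof.
apply: continuous_measurable_fun => x.
by apply: cvgD; [exact: mulrl_continuous|exact: cvg_cst].
Qed.

(** Both sides are measures in A, hence it is enough to compare them on
    half-open intervals. The preimage of such an interval is closed on the right
    or on the left according to the sign of c. *)
Lemma lebesgue_measure_affine (R : realType) (c d : R) (A : set R) :
    c != 0 -> measurable A ->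
  (@lebesgue_measure R A =
    `|c|%:E * @lebesgue_measure R ((fun x => c * x + d)%R @^-1` A))%E.
Proof.
move=> c0 mA.
pose phi (x : measurableTypeR R) : measurableTypeR R := c * x + d.
have mphi : measurable_fun setT phi by exact: measurable_affine.
(* The canonical measure on a push-forward depends on the measurability of phi,
   which is supplied afterwards. *)
pose nu : {measure set (measurableTypeR R) -> \bar R} :=
  mscale (NngNum (normr_ge0 c)) (pushforward (@lebesgue_measure R) phi).
pose mu := nu mphi.
rewrite -[RHS]/(mu A).
apply: lebesgue_measure_unique => // _ [[u v] _ <-].
rewrite /mu/= /mscale/= /pushforward.
have [cn|cp|] := ltgtP c 0; last by move/eqP; rewrite (negbTE c0).
- rewrite (_ : _ @^-1` _ = `[(v - d) / c, (u - d) / c[%classic); last first.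
    by apply/seteqP; split => x /=;
      rewrite !in_itv/= ler_ndivrMr// ltr_ndivlMr// [x * c]mulrC ltrBlDr
        lerBrDr andbC.
  rewrite !lebesgue_measure_itv/= !lte_fin ltr_nM2r ?invr_lt0// ltrD2r.
  case: ifP => // uv; rewrite ?mule0// ltr0_norm// -!EFinB -EFinM; congr EFin.
  by field.
- rewrite (_ : _ @^-1` _ = `](u - d) / c, (v - d) / c]%classic); last first.
    by apply/seteqP; split => x /=;
      rewrite !in_itv/= ltr_pdivrMr// ler_pdivlMr// [x * c]mulrC ltrBlDr
        lerBrDr.
  rewrite !lebesgue_measure_itv/= !lte_fin ltr_pM2r ?invr_gt0// ltrD2r.
  case: ifP => // uv; rewrite ?mule0// gtr0_norm// -!EFinB -EFinM; congr EFin.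
  by field.
Qed.

Lemma ge0_integral_affine (R : realType) (c d : R) (D : set R)
    (f : R -> \bar R) :
    c != 0 -> measurable D -> measurable_fun D f ->
    (forall x, D x -> 0 <= f x)%E ->
  (\int[@lebesgue_measure R]_(x in (fun x => c * x + d)%R @^-1` D)
      f (c * x + d)%R =
    `|c|^-1%:E * \int[@lebesgue_measure R]_(x in D) f x)%E.
Proof.
move=> c0 mD mf f0.
pose phi (x : measurableTypeR R) : measurableTypeR R := c * x + d.
have mphi : measurable_fun setT phi by exact: measurable_affine.
pose nu : {measure set (measurableTypeR R) -> \bar R} :=
  pushforward (@lebesgue_measure R) phi.
have -> : (\int[@lebesgue_measure R]_(x in D) f x =
    `|c|%:E * \int[nu mphi]_(x in D) f x)%E.
  rewrite -(ge0_integral_mscale _ _ (NngNum (normr_ge0 c)))//.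
  apply: eq_measure_integral => A mA _.
  exact: lebesgue_measure_affine.
rewrite muleA -EFinM mulVf ?normr_eq0// mul1e.
rewrite (ge0_integral_pushforward mphi)//.
by move=> x /set_mem; exact: f0.
Qed.

(** The positive and negative parts are transported separately; integrability
    makes their difference meaningful. *)
Lemma Rintegral_affine (R : realType) (c d : R) (D : set R) (f : R -> R) :
    c != 0 -> measurable D ->
    (@lebesgue_measure R).-integrable D (EFin \o f) ->
  \int[@lebesgue_measure R]_(x in (fun x => c * x + d) @^-1` D) f (c * x + d) =
    `|c|^-1 * \int[@lebesgue_measure R]_(x in D) f x.
Proof.
move=> c0 mD intf; rewrite /Rintegral.
have mf := measurable_int _ intf.
pose p : \bar R := (\int[@lebesgue_measure R]_(x in D) (EFin \o f)^\+ x)%E.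
pose n : \bar R := (\int[@lebesgue_measure R]_(x in D) (EFin \o f)^\- x)%E.
have fp : p \is a fin_num by exact: integrable_pos_fin_num.
have fn : n \is a fin_num by exact: integrable_neg_fin_num.
transitivity (fine (`|c|^-1%:E * p - `|c|^-1%:E * n)%E).
  rewrite /p /n -!(ge0_integral_affine d c0)//; last 2 first.
  - exact: measurable_funeneg.
  - exact: measurable_funepos.
  pose phi x := c * x + d.
  by rewrite [in LHS]integralE (funepos_comp (EFin \o f) phi)
    (funeneg_comp (EFin \o f) phi).
rewrite -muleBr ?fin_num_adde_defl ?fin_numN//.
have fpn : (p - n)%E \is a fin_num by rewrite (fin_numB p n) fp fn.
by rewrite fineM// [in RHS]integralE.
Qed.

(** * Double integration by parts *)

Lemma integrable_continuousM (R : realType) (a b : R) (u g : R -> R) :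
    {within `[a, b], continuous u} ->
    (@lebesgue_measure R).-integrable `[a, b] (EFin \o g) ->
  (@lebesgue_measure R).-integrable `[a, b] (EFin \o (fun x => u x * g x)).
Proof.
move=> cu ig; have mD : measurable `[a, b]%classic by exact: measurable_itv.
rewrite (_ : _ \o _ = (EFin \o u) \* (EFin \o g))%E//.
apply: integrableMr => //.
  exact: subspace_continuous_measurable_fun.
have [M [_ uM]] :=
  compact_bounded (continuous_compact cu (@segment_compact R a b)).
by exists M; split; rewrite ?num_real// => ? ? ? ?; exact: uM.
Qed.

(** This is the integrated form of (u f' - u' f)' = u f'' - u'' f, whose
    right-hand side is integrable but possibly discontinuous, like f''. This is
    where the fundamental theorem above is used. *)
Lemma Rintegral_Green (R : realType) (a b : R) (f u u1 u2 : R -> R) :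
    a <= b -> (forall x, a <= x <= b -> derivable f x 1) ->
    (forall x, a <= x <= b -> derivable (derive1 f) x 1) ->
    (@lebesgue_measure R).-integrable `[a, b] (EFin \o derive1n 2 f) ->
    (forall x, a <= x <= b -> is_derive x 1 u (u1 x)) ->
    (forall x, a <= x <= b -> is_derive x 1 u1 (u2 x)) ->
    {within `[a, b], continuous u2} ->
  \int[@lebesgue_measure R]_(x in `[a, b]) (u x * derive1n 2 f x) =
    u b * derive1 f b - u1 b * f b - (u a * derive1 f a - u1 a * f a) +
    \int[@lebesgue_measure R]_(x in `[a, b]) (u2 x * f x).
Proof.
move=> ab df ddf if2 du du1 cu2; set L := @lebesgue_measure R.
have mD : measurable `[a, b]%classic by exact: measurable_itv.
have inE' x : x \in `[a, b]%classic -> a <= x <= b by rewrite inE/= in_itv.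
have ctsD (g : R -> R) : (forall x, a <= x <= b -> derivable g x 1) ->
    {within `[a, b], continuous g}.
  move=> dg; apply: derivable_within_continuous => x.
  by rewrite in_itv; exact: dg.
have cu : {within `[a, b], continuous u}.
  by apply: ctsD => x /du dux; exact: ex_derive.
have cf := ctsD _ df.
have iuf2 : L.-integrable `[a, b] (EFin \o (fun x => u x * derive1n 2 f x)).
  exact: integrable_continuousM.
have iu2f : L.-integrable `[a, b] (EFin \o (fun x => u2 x * f x)).
  apply: continuous_compact_integrable; first exact: segment_compact.
  by move=> x; apply: cvgM; [exact: cu2|exact: cf].
pose G x := u x * derive1 f x - u1 x * f x.
have dG x : a <= x <= b -> is_derive x 1 G (u x * derive1n 2 f x - u2 x * f x).
  move=> xab; have dux := du _ xab; have du1x := du1 _ xab.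
  have dfx := DeriveDef (df _ xab) (esym (derive1E f x)).
  have ddfx := DeriveDef (ddf _ xab) (esym (derive1E (derive1 f) x)).
  apply: is_derive_eq.
  rewrite -![_ *: _]/(_ * _) /=; ring.
have G' x : x \in `[a, b]%classic ->
    derive1 G x = u x * derive1n 2 f x - u2 x * f x.
  by move=> /inE' /dG dGx; rewrite derive1E derive_val.
have := @Rintegral_derive1 R G a b ab.
rewrite (eq_Rintegral L G') RintegralB// => GE.
apply/eqP; rewrite -subr_eq; apply/eqP; apply: GE.
- by move=> x /dG dGx; exact: ex_derive.
- apply: (@eq_integrable _ _ _ L _ mD
    (EFin \o (fun x => u x * derive1n 2 f x - u2 x * f x))).
    by move=> x xab /=; rewrite G'.
  rewrite (_ : _ \o _ = (EFin \o (fun x => u x * derive1n 2 f x)%R) \-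
    (EFin \o (fun x => u2 x * f x)%R))%E//.
  exact: integrableB.
Qed.

Lemma Rintegral_itv_split (R : realType) (a m b : R) (g : R -> R) :
    a <= m <= b -> (@lebesgue_measure R).-integrable `[a, b] (EFin \o g) ->
  \int[@lebesgue_measure R]_(x in `[a, b]) g x =
    \int[@lebesgue_measure R]_(x in `[a, m]) g x +
    \int[@lebesgue_measure R]_(x in `[m, b]) g x.
Proof.
move=> /andP[am mb] ig.
rewrite -(@Rintegral_itv_obnd_cbnd _ m (BRight b)); last first.
  apply: integrableS ig; [exact: measurable_itv|exact: measurable_itv|].
  by apply: subset_itv; rewrite bnd_simp.
by rewrite -(@Rintegral_itvB _ _ (BLeft a) (BRight b) m ig)// addrC subrK.
Qed.

(** * The kernel and the identity *)

(** The kernel is symmetric under t -> 1 - t; written with min(t, 1 - t) it is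
    given by a single formula, from which its continuity is clear. *)
Lemma kernel_kE (R : realType) (lambda t : R) :
  kernel_k lambda t = 1 / 2 * Num.min t (1 - t) * (Num.min t (1 - t) - lambda).
Proof.
have [t2|t2] := leP t (1 / 2).
  by rewrite /kernel_k t2 min_l//; lra.
by rewrite kernel_k_right ?ltW// min_r; [ring|lra].
Qed.

Theorem lemma2 (R : realType) (I : set R) (openI : open I)
  (intervalI : is_interval I) (a b : R) (aI : I a) (bI : I b) (ab : a < b)
  (f : R -> R)
  (df : forall x : R, I x -> derivable f x 1)
  (ddf : forall x : R, I x -> derivable (derive1 f) x 1)
  (intf : (@lebesgue_measure R).-integrable `[a, b] (EFin \o derive1n 2 f))
  (lambda : R) (lambda01 : 0 <= lambda <= 1) :
  (lambda - 1) * f ((a + b) / 2) - lambda * ((f a + f b) / 2)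
    + 1 / (b - a) * (\int[@lebesgue_measure R]_(x in `[a, b]) f x)%R
  = (b - a) ^+ 2 *
    (\int[@lebesgue_measure R]_(t in `[0, 1])
       (kernel_k lambda t * derive1n 2 f (t * a + (1 - t) * b)))%R.
Proof.
have Iab x : a <= x <= b -> I x by move=> xab; exact: intervalI aI bI _ xab.
set L := b - a; have L0 : 0 < L by rewrite subr_gt0.
have nL0 : L != 0 by rewrite gt_eqF.
set m := (a + b) / 2; have amb : a <= m <= b by rewrite /m; lra.
have /andP[am mb] := amb.
pose q y := 1 / 2 * (y / L) * (y / L - lambda).
pose q1 y := (y / L - lambda / 2) / L.
have dq y : is_derive y (1 : R) q (q1 y).
  have -> : q = fun y => (2^-1 / L ^+ 2) *: (y ^+ 2) - (lambda / 2 / L) *: y.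
    by apply/funext => z; rewrite /q -![_ *: _]/(_ * _); field.
  apply: is_derive_eq; rewrite /q1 -![_ *: _]/(_ * _); field.
  exact: nL0.
have dq1 y : is_derive y (1 : R) q1 (L ^- 2).
  have -> : q1 = fun y => (L ^- 2) *: y - cst (lambda / 2 / L) y.
    by apply/funext => z; rewrite /q1 -![_ *: _]/(_ * _) /=; field.
  apply: is_derive_eq; rewrite -![_ *: _]/(_ * _); field.
  exact: nL0.
pose K x := q (Num.min (x - a) (b - x)).
have kK t : kernel_k lambda t = K ((a - b) * t + b).
  rewrite /K /q kernel_kE.
  have -> : Num.min ((a - b) * t + b - a) (b - ((a - b) * t + b)) / L =
      Num.min t (1 - t); last by [].
  rewrite minC (_ : b - _ = L * t); last by rewrite /L; ring.
  rewrite (_ : _ - a = L * (1 - t)); last by rewrite /L; ring.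
  by rewrite -minr_pMr ?ltW// mulrC mulKf.
have cK : {within `[a, b], continuous K}.
  apply: continuous_subspaceT => x.
  apply: (@continuous_comp R R R (fun y => Num.min (y - a) (b - y)) q).
    apply: (@continuous_min R R^o (fun y => y - a) (fun y => b - y)).
      by apply: cvgB; [exact: cvg_id|exact: cvg_cst].
    by apply: cvgB; [exact: cvg_cst|exact: cvg_id].
  exact/differentiable_continuous/derivable1_diffP/ex_derive.
have iK := integrable_continuousM cK intf.
have -> : \int[@lebesgue_measure R]_(t in `[0, 1])
      (kernel_k lambda t * derive1n 2 f (t * a + (1 - t) * b)) =
    L^-1 * \int[@lebesgue_measure R]_(x in `[a, b]) (K x * derive1n 2 f x).
  have c0 : a - b != 0 by rewrite subr_eq0 lt_eqF.
  have mab : measurable `[a, b]%classic by exact: measurable_itv.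
  have abL : `|a - b| = L by rewrite distrC gtr0_norm.
  rewrite -abL -(Rintegral_affine b c0 mab iK).
  have -> : (fun t => (a - b) * t + b) @^-1` `[a, b] = `[0, 1]%classic.
    by apply/seteqP; split => x /=; rewrite !in_itv/= => /andP[]; nra.
  apply: eq_Rintegral => t _; rewrite kK; congr (_ * derive1n 2 f _).
  by ring.
have sub1 x : a <= x <= m -> a <= x <= b by lra.
have sub2 x : m <= x <= b -> a <= x <= b by lra.
have if2l : (@lebesgue_measure R).-integrable `[a, m] (EFin \o derive1n 2 f).
  apply: integrableS intf; [exact: measurable_itv|exact: measurable_itv|].
  by move=> x; rewrite /= !in_itv/=; exact: sub1.
have if2r : (@lebesgue_measure R).-integrable `[m, b] (EFin \o derive1n 2 f).
  apply: integrableS intf; [exact: measurable_itv|exact: measurable_itv|].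
  by move=> x; rewrite /= !in_itv/=; exact: sub2.
have cf : {within `[a, b], continuous f}.
  by apply: derivable_within_continuous => x; rewrite in_itv => /Iab /df.
have fi : (@lebesgue_measure R).-integrable `[a, b] (EFin \o f).
  by apply: continuous_compact_integrable => //; exact: segment_compact.
have Kl : \int[@lebesgue_measure R]_(x in `[a, m]) (K x * derive1n 2 f x) =
    q (L / 2) * derive1 f m - q1 (L / 2) * f m
    - (q 0 * derive1 f a - q1 0 * f a)
    + L^-2 * \int[@lebesgue_measure R]_(x in `[a, m]) f x.
  rewrite -RintegralZl; last 2 first.
  - exact: measurable_itv.
  - apply: integrableS fi; [exact: measurable_itv|exact: measurable_itv|].
    by move=> x; rewrite /= !in_itv/=; exact: sub1.
  have ma : m - a = L / 2 by rewrite /m /L; lra.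
  have du x : a <= x <= m ->
      is_derive x (1 : R) (fun x => q (x - a)) (q1 (x - a)).
    by move=> _; have dqx := dq (x - a); apply: is_derive_eq; ring.
  have du1 x : a <= x <= m ->
      is_derive x (1 : R) (fun x => q1 (x - a)) (L ^- 2).
    by move=> _; have dqx := dq1 (x - a); apply: is_derive_eq; ring.
  have := Rintegral_Green am (fun x xam => df x (Iab x (sub1 x xam)))
    (fun x xam => ddf x (Iab x (sub1 x xam))) if2l du du1
    (continuous_subspaceT (@cst_continuous R R _)).
  rewrite subrr ma => <-.
  apply: eq_Rintegral => x; rewrite inE/= in_itv/= => /andP[ax xm].
  by rewrite /K min_l//; move: xm; rewrite /m; lra.
have Kr : \int[@lebesgue_measure R]_(x in `[m, b]) (K x * derive1n 2 f x) =
    q 0 * derive1 f b + q1 0 * f b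
    - (q (L / 2) * derive1 f m + q1 (L / 2) * f m)
    + L^-2 * \int[@lebesgue_measure R]_(x in `[m, b]) f x.
  rewrite -RintegralZl; last 2 first.
  - exact: measurable_itv.
  - apply: integrableS fi; [exact: measurable_itv|exact: measurable_itv|].
    by move=> x; rewrite /= !in_itv/=; exact: sub2.
  have bm : b - m = L / 2 by rewrite /m /L; lra.
  have du x : m <= x <= b ->
      is_derive x (1 : R) (fun x => q (b - x)) (- q1 (b - x)).
    by move=> _; have dqx := dq (b - x); apply: is_derive_eq; ring.
  have du1 x : m <= x <= b ->
      is_derive x (1 : R) (fun x => - q1 (b - x)) (L ^- 2).
    by move=> _; have dqx := dq1 (b - x); apply: is_derive_eq; ring.
  have := Rintegral_Green mb (fun x xam => df x (Iab x (sub2 x xam)))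
    (fun x xam => ddf x (Iab x (sub2 x xam))) if2r du du1
    (continuous_subspaceT (@cst_continuous R R _)).
  rewrite subrr bm !mulNr !opprK => <-.
  apply: eq_Rintegral => x; rewrite inE/= in_itv/= => /andP[mx xb].
  by rewrite /K min_r//; move: mx; rewrite /m; lra.
rewrite (Rintegral_itv_split amb iK) (Rintegral_itv_split amb fi) Kl Kr.
have q0 : q 0 = 0 by rewrite /q mul0r mulr0 mul0r.
have q10 : q1 0 = - (lambda / 2) / L by rewrite /q1 mul0r sub0r.
have q1m : q1 (L / 2) = (1 - lambda) / 2 / L.
  by rewrite /q1 (mulrAC L) divff// -mulrBl.
rewrite q0 q10 q1m.
(* The integrals and q (L / 2) are now mere parameters of a field identity. *)
move: (q (L / 2)) (\int[@lebesgue_measure R]_(x in `[a, m]) f x)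
  (\int[@lebesgue_measure R]_(x in `[m, b]) f x) => qm A B.
clear -nL0; clearbody m L.
by field.
Qed.
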